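(* For the root system of type $\widetilde A_1$ with $n=2$, $$Z_0(\mathbf x;u)=\frac{(u^2\mathbf x^\delta;\mathbf x^{2\delta})_\infty}{(ux_0;\mathbf x^\delta)_\infty\,(ux_1;\mathbf x^\delta)_\infty}.$$
   Context: $\widetilde A_1$ is the affine root system with generalized Cartan matrix $\begin{pmatrix}2&-2\\-2&2\end{pmatrix}$, simple roots $\alpha_0,\alpha_1$, Weyl group $W$ (infinite dihedral) generated by the simple reflections $\sigma_0,\sigma_1$, minimal positive imaginary root $\delta=\alpha_0+\alpha_1$, positive real roots $\Phi^+_{\rm re}=\{\alpha_i+k\delta\mid i=0,1,\ k\ge0\}$, and positive imaginary roots $k\delta$ ($k\ge1$), each of multiplicity 1. For $\lambda=k_0\alpha_0+k_1\alpha_1$, $\mathbf x^\lambda=x_0^{k_0}x_1^{k_1}$; in particular $\mathbf x^\delta=x_0x_1$. $\sigma_i\mathbf x$ is defined by $x_i\mapsto x_i^{-1}$, $x_{1-i}\mapsto x_{1-i}x_i^2$. $u$ is a parameter. The untwisted Chinta-Gunnells action (for $n=2$, $g_1=u$, $q=u^2$) is the right action of $W$ on rational functions with $f\vert^{\mathrm{CG}}_0\sigma_i(\mathbf x)=\frac{1-u/x_i}{1-ux_i}f(\sigma_i\mathbf x)$, and the related action is $f\vert_0\sigma_i=-x_i^2\cdot f\vert_0^{\mathrm{CG}}\sigma_i$. Set $\Delta(\mathbf x)=\prod_{\alpha\in\Phi^+_{\rm re}}(1-\mathbf x^{2\alpha})\prod_{k\ge1}(1-\mathbf x^{2k\delta})$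 and $Z_0(\mathbf x;u)=\Delta(\mathbf x)^{-1}\sum_{\sigma\in W}1\vert_0\sigma(\mathbf x)$ (a power series in $x_0,x_1$ with coefficients polynomial in $u$). $(a;p)_\infty=\prod_{k\ge0}(1-ap^k)$. *)

(* Defs.v *)
From HB Require Import structures.
From mathcomp Require Import all_boot all_order all_algebra.
From mathcomp Require Import boolp classical_sets functions cardinality fsbigop.
From mathcomp Require Import mpoly.
From mathcomp Require Import zify ring.

Set Implicit Arguments.
Unset Strict Implicit.
Unset Printing Implicit Defensive.

Import GRing.Theory.

Local Open Scope classical_set_scope.
Local Open Scope ring_scope.

Record fps (n : nat) (R : Type) : Type := Fps { fcoef : 'X_{1..n} -> R }.

HB.instance Definition _ n R := gen_eqMixin (fps n R).
HB.instance Definition _ n R := gen_choiceMixin (fps n R).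

Lemma fpsP n R (f g : fps n R) : fcoef f =1 fcoef g <-> f = g.
Proof. by split=> [|->//]; case: f g => f [g] /= /funext ->. Qed.

Section FpsRing.
Context {n : nat} {R : comNzRingType}.
Implicit Types (f g h : fps n R) (p q : {mpoly R[n]}) (m : 'X_{1..n}).

Definition fps_of_mpoly p : fps n R := Fps (fun m => p@_m).

Definition fps_opp f : fps n R := Fps (fun m => - fcoef f m).
Definition fps_add f g : fps n R := Fps (fun m => fcoef f m + fcoef g m).

(* The Cauchy product, indexed as in [mcoeffM]. *)
Definition fps_mul f g : fps n R := Fps (fun m =>
  \sum_(k : 'X_{1..n < (mdeg m).+1, (mdeg m).+1} | m == (k.1 + k.2)%MM)
    fcoef f k.1 * fcoef g k.2).

Fact fps_addA : associative fps_add.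
Proof. by move=> f g h; apply/fpsP => m /=; rewrite addrA. Qed.
Fact fps_addC : commutative fps_add.
Proof. by move=> f g; apply/fpsP => m /=; rewrite addrC. Qed.
Fact fps_add0 : left_id (fps_of_mpoly 0) fps_add.
Proof. by move=> f; apply/fpsP => m /=; rewrite mcoeff0 add0r. Qed.
Fact fps_addN : left_inverse (fps_of_mpoly 0) fps_opp fps_add.
Proof. by move=> f; apply/fpsP => m /=; rewrite mcoeff0 addNr. Qed.

HB.instance Definition _ :=
  GRing.isZmodule.Build (fps n R) fps_addA fps_addC fps_add0 fps_addN.

Definition fps_trunc (d : nat) f : {mpoly R[n]} :=
  \sum_(m : 'X_{1..n < d}) fcoef f m *: 'X_[m].

Lemma mcoeff_trunc d f m : (mdeg m < d)%N -> (fps_trunc d f)@_m = fcoef f m.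
Proof. exact: mcoeff_mpoly. Qed.

(* Coefficients of a product only depend on coefficients of smaller degree. *)
Lemma fcoef_mul f g p q m :
  (forall k, (mdeg k <= mdeg m)%N -> fcoef f k = p@_k) ->
  (forall k, (mdeg k <= mdeg m)%N -> fcoef g k = q@_k) ->
  fcoef (fps_mul f g) m = (p * q)@_m.
Proof.
move=> fp gq; rewrite mcoeffM; apply: eq_bigr => -[k l] _.
by rewrite fp ?gq // -ltnS bmdeg.
Qed.

Lemma fcoef_mul_trunc f g m : fcoef (fps_mul f g) m =
  (fps_trunc (mdeg m).+1 f * fps_trunc (mdeg m).+1 g)@_m.
Proof. by apply: fcoef_mul => k km; rewrite mcoeff_trunc. Qed.

Fact fps_mulA : associative fps_mul.
Proof.
move=> f g h; apply/fpsP => m; set d := (mdeg m).+1.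
rewrite (@fcoef_mul _ _ (fps_trunc d f) (fps_trunc d g * fps_trunc d h)).
- rewrite (@fcoef_mul _ _ (fps_trunc d f * fps_trunc d g) (fps_trunc d h)).
  + by rewrite mulrA.
  + move=> k km; apply: fcoef_mul => l lk; rewrite mcoeff_trunc //;
    exact: leq_trans lk km.
  + by move=> k km; rewrite mcoeff_trunc.
- by move=> k km; rewrite mcoeff_trunc.
- move=> k km; apply: fcoef_mul => l lk; rewrite mcoeff_trunc //;
  exact: leq_trans lk km.
Qed.

Fact fps_mulC : commutative fps_mul.
Proof.
by move=> f g; apply/fpsP => m; rewrite !fcoef_mul_trunc mulrC.
Qed.

Fact fps_mul1 : left_id (fps_of_mpoly 1) fps_mul.
Proof.
move=> f; apply/fpsP => m.
rewrite (@fcoef_mul _ _ 1 (fps_trunc (mdeg m).+1 f)) // ?mul1r ?mcoeff_trunc //.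
by move=> k km; rewrite mcoeff_trunc.
Qed.

Fact fps_mulDl : left_distributive fps_mul fps_add.
Proof.
move=> f g h; apply/fpsP => m /=; rewrite -big_split /=.
by apply: eq_bigr => k _; rewrite mulrDl.
Qed.

Fact fps_1neq0 : fps_of_mpoly 1 != fps_of_mpoly 0.
Proof.
apply/eqP => /fpsP /(_ 0%MM) /= /eqP.
by rewrite mcoeff1 mcoeff0 eqxx oner_eq0.
Qed.

HB.instance Definition _ := GRing.Zmodule_isComNzRing.Build (fps n R)
  fps_mulA fps_mulC fps_mul1 fps_mulDl fps_1neq0.

Definition fps_unit : {pred fps n R} := fun f => `[< exists g, g * f = 1 >].
Definition fps_inv f : fps n R := xget f [set g | g * f = 1].

Fact fps_mulVx : {in fps_unit, left_inverse 1 fps_inv *%R}.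
Proof. by move=> f /asboolP; apply: xgetPex. Qed.
Fact fps_unitPl f g : g * f = 1 -> fps_unit f.
Proof. by move=> gf; apply/asboolP; exists g. Qed.
Fact fps_invr_out : {in [predC fps_unit], fps_inv =1 id}.
Proof.
move=> f; rewrite inE => /asboolP nf; apply: xgetPN => g gf.
by apply: nf; exists g.
Qed.

HB.instance Definition _ := GRing.ComNzRing_hasMulInverse.Build (fps n R)
  fps_mulVx fps_unitPl fps_invr_out.

Lemma fcoef1 m : fcoef (1 : fps n R) m = (m == 0%MM)%:R.
Proof. exact: mcoeff1. Qed.

Lemma fcoef0 m : fcoef (0 : fps n R) m = 0.
Proof. exact: mcoeff0. Qed.

Lemma fcoefB f g m : fcoef (f - g) m = fcoef f m - fcoef g m.
Proof. by []. Qed.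

Lemma fcoefM f g m : fcoef (f * g) m =
  \sum_(k : 'X_{1..n < (mdeg m).+1, (mdeg m).+1} | m == (k.1 + k.2)%MM)
    fcoef f k.1 * fcoef g k.2.
Proof. by []. Qed.

Fact fps_of_mpoly_is_zmod_morphism : zmod_morphism fps_of_mpoly.
Proof. by move=> p q; apply/fpsP => m /=; rewrite mcoeffB. Qed.
Fact fps_of_mpoly_is_monoid_morphism : monoid_morphism fps_of_mpoly.
Proof. by split=> // p q; apply/fpsP => m; apply/esym/fcoef_mul. Qed.
HB.instance Definition _ := GRing.isZmodMorphism.Build
  {mpoly R[n]} (fps n R) fps_of_mpoly fps_of_mpoly_is_zmod_morphism.
HB.instance Definition _ := GRing.isMonoidMorphism.Build
  {mpoly R[n]} (fps n R) fps_of_mpoly fps_of_mpoly_is_monoid_morphism.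

(* Limits are coefficientwise, i.e. for the adic topology of the ideal
    generated by the variables. *)
Definition fps_cvg (F : nat -> fps n R) (f : fps n R) : Prop :=
  forall m, exists N, forall k, (N <= k)%N -> fcoef (F k) m = fcoef f m.

Definition fps_lim (F : nat -> fps n R) : fps n R := xget 0 (fps_cvg F).

Definition fps_prod (F : nat -> fps n R) : fps n R :=
  fps_lim (fun N => \prod_(k < N) F k).

Definition fps_summable (I : choiceType) (F : I -> fps n R) : Prop :=
  forall m, finite_set [set i | fcoef (F i) m != 0].

Definition fps_sum (I : choiceType) (F : I -> fps n R) : fps n R :=
  Fps (fun m => \sum_(i \in [set: I]) fcoef (F i) m).

Definition qpoch (a p : fps n R) : fps n R :=
  fps_prod (fun k => 1 - a * p ^+ k).

Lemma fps_lim_unique F f g : fps_cvg F f -> fps_cvg F g -> f = g.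
Proof.
move=> Ff Fg; apply/fpsP => m.
have [N hN] := Ff m; have [M hM] := Fg m.
by rewrite -(hN (maxn N M)) ?leq_maxl // hM // leq_maxr.
Qed.

Lemma fps_limE F f : fps_cvg F f -> fps_lim F = f.
Proof.
by move=> Ff; apply: xget_unique => // g Fg; apply: fps_lim_unique Fg Ff.
Qed.

Lemma fcoefM_low f g m :
  (forall k, (mdeg k <= mdeg m)%N -> fcoef g k = (k == 0%MM)%:R) ->
  fcoef (f * g) m = fcoef f m.
Proof.
move=> g1; rewrite -[in RHS](mulr1 f) !fcoefM; apply: eq_bigr => -[k l] _ /=.
have lm : (mdeg l <= mdeg m)%N by rewrite -ltnS bmdeg.
by rewrite g1 // mcoeff1.
Qed.

Lemma fps_prod_cvg (F : nat -> fps n R) :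
  (forall k m, (mdeg m < k)%N -> fcoef (F k) m = (m == 0%MM)%:R) ->
  fps_cvg (fun N => \prod_(k < N) F k) (fps_prod F).
Proof.
move=> F1; rewrite /fps_prod.
set P := fun N => _.
pose f := Fps (fun m => fcoef (P (mdeg m).+1) m).
have Pf : fps_cvg P f.
  move=> m; exists (mdeg m).+1 => k; elim: k => // k IHk.
  rewrite leq_eqVlt => /predU1P[[<-]//|mk].
  rewrite -(IHk mk) {1}/P big_ord_recr /=; apply: fcoefM_low => l lm.
  by apply: F1; apply: leq_ltn_trans lm mk.
by rewrite (fps_limE Pf).
Qed.

Lemma fcoef_expr_low f k m :
  fcoef f 0%MM = 0 -> (mdeg m < k)%N -> fcoef (f ^+ k) m = 0.
Proof.
move=> f0; elim: k m => // k IHk m mk.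
rewrite exprS fcoefM big1 // => -[k1 k2] /eqP /= mE.
have [k10|k10] := eqVneq (k1 : 'X_{1..n}) 0%MM; first by rewrite k10 f0 mul0r.
have dE : mdeg m = (mdeg k1 + mdeg k2)%N by rewrite -mdegD; apply: congr1 mE.
rewrite IHk ?mulr0 // -ltnS; apply: leq_ltn_trans mk; rewrite [leqRHS]dE.
by rewrite -add1n leq_add2r lt0n mdeg_eq0.
Qed.

Lemma fps_unit1 f : fcoef f 0%MM = 1 -> f \is a GRing.unit.
Proof.
move=> f1; pose h := 1 - f.
have h0 : fcoef h 0%MM = 0 by rewrite fcoefB fcoef1 eqxx f1 subrr.
pose G d := \sum_(k < d) h ^+ k.
have Gstep m d : (mdeg m < d)%N -> fcoef (G d) m = fcoef (G (mdeg m).+1) m.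
  elim: d => // d IHd; rewrite ltnS leq_eqVlt => /predU1P[<-//|md].
  by rewrite -IHd // /G big_ord_recr /= fcoef_expr_low // addr0.
pose g := Fps (fun m => fcoef (G (mdeg m).+1) m).
apply/asboolP; exists g; apply/fpsP => m.
have -> : fcoef (g * f) m = fcoef (G (mdeg m).+1 * f) m.
  rewrite !fcoefM; apply: eq_bigr => -[k l] _ /=; congr (_ * _).
  by apply/esym/Gstep; apply: bmdeg.
have -> : G (mdeg m).+1 * f = 1 - h ^+ (mdeg m).+1.
  rewrite -[RHS]opprB subrX1 -mulNr opprB mulrC; congr (_ * _).
  by rewrite opprB addrC subrK.
by rewrite fcoefB fcoef_expr_low // subr0.
Qed.

End FpsRing.

Notation "p %:S" := (fps_of_mpoly p) (format "p %:S") : ring_scope.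

Definition cartan : 'M[int]_2 := \matrix_(i, j) (if i == j then 2 else - 2).

(* Acts on column vectors of coordinates in the basis of simple roots:
   [sigma_i alpha_j = alpha_j - a_ij alpha_i]. *)
Definition refl (i : 'I_2) : 'M[int]_2 :=
  \matrix_(k, j) ((k == j)%:R - cartan i j * (k == i)%:R).

Definition refl_word (s : seq 'I_2) : 'M[int]_2 := \prod_(i <- s) refl i.

Definition weyl : Type := {w : 'M[int]_2 | `[< exists s, w = refl_word s >]}.
HB.instance Definition _ := Choice.on weyl.

Definition weyl_word (w : weyl) : seq 'I_2 :=
  xget [::] [set s | sval w = refl_word s].

Lemma weyl_wordP w : sval w = refl_word (weyl_word w).
Proof.
have wW : exists s, sval w = refl_word s by case: w => M /= /asboolP.
exact: (xgetPex [::] wW).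
Qed.

(* The right action of the Weyl group in which [sigma_i] acts by [op i]; it
   does not depend on the choice of [weyl_word] when each [op i] is an
   involution, see [weyl_act1], [weyl_actG] and [weyl_actM]. *)
Definition weyl_act (T : Type) (op : 'I_2 -> T -> T) (w : weyl) (f : T) : T :=
  foldl (fun g i => op i g) f (weyl_word w).

Lemma refl_word_cat s t : refl_word (s ++ t) = refl_word s * refl_word t.
Proof. exact: big_cat. Qed.

Lemma reflE i k j : refl i k j =
  if k == i then (if j == i then -1 else 2) else (k == j)%:R.
Proof.
rewrite !mxE.
by case: i k j => [[|[|]]//= ?] [[|[|]]//= ?] [[|[|]]//= ?].
Qed.

Lemma refl_refl i : refl i * refl i = 1.
Proof.
apply/matrixP => k j; rewrite !mxE !big_ord_recl big_ord0 addr0 !reflE.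
by case: i k j => [[|[|]]//= ?] [[|[|]]//= ?] [[|[|]]//= ?].
Qed.

Lemma refl_word_rev s : refl_word s * refl_word (rev s) = 1.
Proof.
elim: s => [|i s IHs]; first by rewrite /refl_word /rev big_nil mulr1.
rewrite rev_cons -cats1 -cat1s !refl_word_cat mulrA.
by rewrite -[_ * refl_word s * _]mulrA IHs mulr1 /refl_word !big_seq1 refl_refl.
Qed.

(* On a nonempty word without repetitions, the coordinate of the first letter
   dominates after reflecting the root of the other letter of the last one. *)
Lemma refl_word_alt i s : sorted (fun a b => a != b) (i :: s) ->
  exists j : 'I_2,
    1 < (refl_word (i :: s)) i j /\
    (refl_word (i :: s)) (rev_ord i) j < (refl_word (i :: s)) i j.
Proof.
elim: s i => [|k s IHs] i.
  move=> _; exists (rev_ord i); rewrite /refl_word big_seq1 !reflE.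
  by case: i => [[|[|]]//= ?].
move=> /= /andP[ik ks]; have [j []] := IHs _ ks; set M := refl_word (k :: s).
have -> : refl_word [:: i, k & s] = refl i * M.
  by rewrite -[in LHS]cat1s refl_word_cat /refl_word big_seq1.
have -> : k = rev_ord i.
  by apply/eqP; case: i k ik {IHs ks M} => [[|[|]]//= ?] [[|[|]]//= ?].
rewrite rev_ordK => M1 M2; exists j.
rewrite !mxE !big_ord_recl !big_ord0 !addr0 !reflE.
case: i M1 M2 {ik} => [[|[|]]//= i2]; rewrite /rev_ord /=.
- have -> : Ordinal (rev_ord_proof (Ordinal i2)) = lift ord0 ord0 :> 'I_2.
    exact: val_inj.
  by have -> : Ordinal i2 = ord0 :> 'I_2; [exact: val_inj | lia].
- have -> : Ordinal (rev_ord_proof (Ordinal i2)) = ord0 :> 'I_2.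
    exact: val_inj.
  by have -> : Ordinal i2 = lift ord0 ord0 :> 'I_2; [exact: val_inj | lia].
Qed.

Section WeylAct.
Context (T : Type) (op : 'I_2 -> T -> T).
Context (opK : forall i, involutive (op i)).

Let ops := foldl (fun g i => op i g).

Lemma unsorted_split (s : seq 'I_2) : ~~ sorted (fun a b => a != b) s ->
  exists s1 k s2, s = s1 ++ [:: k, k & s2].
Proof.
elim: s => // i [|k s] // IHs; rewrite /= negb_and negbK.
case/orP => [/eqP <-|/IHs[s1 [l [s2 ->]]]]; first by exists [::], i, s.
by exists (i :: s1), l, s2.
Qed.

Lemma ops_refl_word1 s f : refl_word s = 1 -> ops f s = f.
Proof.
have [d] := ubnP (size s); elim: d s f => // d IHd s f sd s1.
have [|/unsorted_split[r [k [t sE]]]] := boolP (sorted (fun a b => a != b) s).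
  case: s sd s1 => // i s _ s1 /refl_word_alt[j []].
  by rewrite s1 mxE; case: (i == j).
move: sd s1; rewrite sE /ops foldl_cat /= opK -foldl_cat => sd s1.
apply: IHd; first by move: sd; rewrite !size_cat /=; lia.
rewrite -s1 -cat1s -(cat1s k t) !refl_word_cat /refl_word !big_seq1.
by rewrite [refl k * (_ * _)]mulrA refl_refl mul1r.
Qed.

Lemma ops_refl_word s t f : refl_word s = refl_word t -> ops f s = ops f t.
Proof.
move=> st; have st1 : refl_word (s ++ rev t) = 1.
  by rewrite refl_word_cat st refl_word_rev.
have ts1 : refl_word (rev t ++ t) = 1.
  by rewrite -{2}[t]revK refl_word_cat refl_word_rev.
rewrite -[LHS](ops_refl_word1 _ ts1) /ops -foldl_cat catA foldl_cat.
by rewrite [foldl _ f _]ops_refl_word1.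
Qed.

Lemma weyl_actE w s f : sval w = refl_word s -> weyl_act op w f = ops f s.
Proof. by move=> ws; apply: ops_refl_word; rewrite -weyl_wordP. Qed.

Lemma weyl_act1 w f : sval w = 1 -> weyl_act op w f = f.
Proof.
by move=> w1; rewrite (@weyl_actE w [::]) // w1 /refl_word big_nil.
Qed.

Lemma weyl_actG w i f : sval w = refl i -> weyl_act op w f = op i f.
Proof.
by move=> wi; rewrite (@weyl_actE w [:: i]) // wi /refl_word big_seq1.
Qed.

Lemma weyl_actM w w1 w2 f : sval w = sval w1 * sval w2 ->
  weyl_act op w f = weyl_act op w2 (weyl_act op w1 f).
Proof.
rewrite (weyl_wordP w1) (weyl_wordP w2) -refl_word_cat => /weyl_actE ->.
by rewrite /ops foldl_cat.
Qed.

End WeylAct.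

Section Rational.
Context {R : idomainType}.

Local Notation K := {fraction {mpoly R[2]}}.
Local Notation "x %:F" := (@tofrac _ x).
Implicit Types (p q : {mpoly R[2]}) (f : K) (i j : 'I_2).

Definition ratC (c : R) : K := (c%:MP)%:F.
Definition ratX (i : 'I_2) : K := ('X_i)%:F.

Definition mpoly_subst (y : 'I_2 -> K) (p : {mpoly R[2]}) : K :=
  mmap (@tofrac _ \o @mpolyC 2 R) y p.

(* [f(y_0, y_1)], computed on the chosen representative of [f]; see
   [rat_subst_frac] for the points used below. *)
Definition rat_subst (y : 'I_2 -> K) (f : K) : K :=
  mpoly_subst y \n_(repr f) / mpoly_subst y \d_(repr f).

Definition sigma_pt (i : 'I_2) : 'I_2 -> K := fun j =>
  if j == i then (ratX i)^-1 else ratX j * ratX i ^+ 2.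

Definition cg_gen (u : R) (i : 'I_2) (f : K) : K :=
  (1 - ratC u / ratX i) / (1 - ratC u * ratX i) * rat_subst (sigma_pt i) f.

Definition cg0_gen (u : R) (i : 'I_2) (f : K) : K :=
  - ratX i ^+ 2 * cg_gen u i f.

Definition cg_act (u : R) : weyl -> K -> K := weyl_act (cg_gen u).
Definition cg0_act (u : R) : weyl -> K -> K := weyl_act (cg0_gen u).

Lemma frac_repr f : (\n_(repr f))%:F / (\d_(repr f))%:F = f.
Proof.
have fracE (x : {ratio {mpoly R[2]}}) :
    (\n_x)%:F / (\d_x)%:F = \pi_({fraction {mpoly R[2]}})%qT x.
  have d0 := denom_ratioP x.
  apply: (canLR (mulfK _)); first by rewrite tofrac_eq0.
  apply/eqP; rewrite eq_sym !piE.
  rewrite FracField.equivfE /FracField.mulf.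
  by rewrite !numden_Ratio ?oner_neq0 ?mulr1 ?mulf_neq0 // mulrC.
by rewrite fracE reprK.
Qed.

Lemma ratX_neq0 i : ratX i != 0.
Proof.
rewrite tofrac_eq0; apply/eqP => /(congr1 (mcoeff U_(i))) /eqP.
by rewrite mcoeff0 mcoeffX eqxx oner_eq0.
Qed.

Lemma mpoly_substM y : {morph mpoly_subst y : p q / p * q}.
Proof. by move=> p q; rewrite /mpoly_subst rmorphM. Qed.

(* Clears denominators in [mpoly_subst (sigma_pt i) 'X_[m]]. *)
Let clear i N (m : 'X_{1..2}) : 'X_{1..2} :=
  [multinom if j == i then (N - m i + 2 * m (rev_ord i))%N else m j | j < 2].

Let clear_inj i N (m1 m2 : 'X_{1..2}) : (m1 i <= N)%N -> (m2 i <= N)%N ->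
  clear i N m1 = clear i N m2 -> m1 = m2.
Proof.
move=> m1N m2N /mnmP e; have := e (rev_ord i); have := e i.
rewrite !mnmE eqxx; have /negbTE-> : rev_ord i != i by case: i {m1N m2N e} => [[|[|]]].
move=> e1 e2; apply/mnmP => j.
have [->|ji] := eqVneq j i; first by lia.
have -> : j = rev_ord i.
  by apply/eqP; case: i j ji {m1N m2N e e1 e2} => [[|[|]]//= ?] [[|[|]]//= ?].
by [].
Qed.

Let mmap1_sigma i N (m : 'X_{1..2}) : (m i <= N)%N ->
  ratX i ^+ N * mmap1 (sigma_pt i) m = ('X_[clear i N m])%:F.
Proof.
move=> mN; have ij : rev_ord i != i by case: i {mN} => [[|[|]]].
have only2 (F : 'I_2 -> K) : \prod_(j < 2) F j = F i * F (rev_ord i).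
  rewrite (bigD1 i) //= (bigD1 (rev_ord i)) //= big1 ?mulr1 // => j.
  by case: i j {mN ij} => [[|[|]]//= ?] [[|[|]]//= ?].
rewrite mpolyXE_id rmorph_prod /= only2 /mmap1 only2 /sigma_pt eqxx.
rewrite (negbTE ij) !mnmE eqxx (negbTE ij) !rmorphXn /= exprVn exprMn -exprM.
rewrite -/(ratX i) -/(ratX (rev_ord i)) exprD.
rewrite -[in LHS](subnK mN) exprD.
rewrite -!mulrA; congr (_ * _).
by rewrite mulVKf ?expf_neq0 ?ratX_neq0 // mulrC.
Qed.

Lemma mpoly_subst_eq0 i p : mpoly_subst (sigma_pt i) p = 0 -> p = 0.
Proof.
move=> p0; pose N := msize p.
have : ratX i ^+ N * mpoly_subst (sigma_pt i) p = 0 by rewrite p0 mulr0.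
have degi (m : 'X_{1..2}) : (mdeg m < N)%N -> (m i <= N)%N.
  by rewrite mdegE (bigD1 i) //=; lia.
rewrite /mpoly_subst (mmapE N) // mulr_sumr.
under eq_bigr => m _.
  rewrite mulrCA mmap1_sigma ?degi ?bmdeg // /= -rmorphM /= mul_mpolyC. over.
rewrite /= -rmorph_sum /= => /eqP; rewrite tofrac_eq0 => /eqP e.
apply/mpolyP => m; rewrite mcoeff0.
have [mN|mN] := ltnP (mdeg m) N; last first.
  by apply: memN_msupp_eq0; apply: contraL mN => /msize_mdeg_lt; rewrite ltnNge.
have := congr1 (mcoeff (clear i N m)) e.
rewrite mcoeff0 raddf_sum (bigD1 (Sub m mN)) //= big1 ?addr0.
  by rewrite mcoeffZ mcoeffX eqxx mulr1.
move=> k km; rewrite mcoeffZ mcoeffX.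
case: eqP => [/clear_inj h|_]; last by rewrite mulr0.
by case/eqP: km; apply/val_inj/h; apply: degi; rewrite ?bmdeg.
Qed.

Lemma mpoly_subst_neq0 i p : p != 0 -> mpoly_subst (sigma_pt i) p != 0.
Proof. by apply: contra_neq => /mpoly_subst_eq0. Qed.

Lemma rat_subst_frac i p q : q != 0 ->
  rat_subst (sigma_pt i) (p%:F / q%:F) =
  mpoly_subst (sigma_pt i) p / mpoly_subst (sigma_pt i) q.
Proof.
move=> q0; rewrite /rat_subst; set f := (X in repr X).
have /eqP := frac_repr f; set n := \n_ _; set d := \d_ _.
have d0 : d != 0 by apply: denom_ratioP.
rewrite eqr_div ?tofrac_eq0 // -!tofracM tofrac_eq => /eqP e.
by apply/eqP; rewrite eqr_div ?mpoly_subst_neq0 // -!mpoly_substM e.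
Qed.

Lemma rat_subst_C i c : rat_subst (sigma_pt i) (ratC c) = ratC c.
Proof.
rewrite -[X in rat_subst _ X]divr1 -tofrac1 rat_subst_frac ?oner_neq0 //.
by rewrite /mpoly_subst mmapC rmorph1 divr1.
Qed.

Lemma rat_subst_X i j : rat_subst (sigma_pt i) (ratX j) = sigma_pt i j.
Proof.
rewrite -[X in rat_subst _ X]divr1 -tofrac1 rat_subst_frac ?oner_neq0 //.
by rewrite /mpoly_subst mmapX mmap1U rmorph1 divr1.
Qed.

Fact rat_subst_is_zmod_morphism i : zmod_morphism (rat_subst (sigma_pt i)).
Proof.
move=> f g; rewrite -(frac_repr f) -(frac_repr g).
move: (\n_(repr f)) (\d_(repr f)) (denom_ratioP (repr f)) => a b b0.
move: (\n_(repr g)) (\d_(repr g)) (denom_ratioP (repr g)) => c d d0.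
rewrite -mulNr addf_div ?tofrac_eq0 // -tofracN -!tofracM -tofracD.
rewrite !rat_subst_frac ?mulf_neq0 // -mulNr addf_div ?mpoly_subst_neq0 //.
by rewrite /mpoly_subst !(rmorphM, rmorphD, rmorphN).
Qed.

Fact rat_subst_is_monoid_morphism i :
  monoid_morphism (rat_subst (sigma_pt i)).
Proof.
split; first by have := rat_subst_C i 1; rewrite /ratC mpolyC1 tofrac1.
move=> f g; rewrite -(frac_repr f) -(frac_repr g).
move: (\n_(repr f)) (\d_(repr f)) (denom_ratioP (repr f)) => a b b0.
move: (\n_(repr g)) (\d_(repr g)) (denom_ratioP (repr g)) => c d d0.
rewrite mulf_div -!tofracM !rat_subst_frac ?mulf_neq0 // mulf_div.
by rewrite !mpoly_substM.
Qed.

HB.instance Definition _ i := GRing.isZmodMorphism.Build K K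
  (rat_subst (sigma_pt i)) (rat_subst_is_zmod_morphism i).
HB.instance Definition _ i := GRing.isMonoidMorphism.Build K K
  (rat_subst (sigma_pt i)) (rat_subst_is_monoid_morphism i).

Lemma rat_substK i : involutive (rat_subst (sigma_pt i)).
Proof.
have polyK p : rat_subst (sigma_pt i) (mpoly_subst (sigma_pt i) p) = p%:F.
  rewrite [in RHS](mpolyE p) /mpoly_subst /mmap !rmorph_sum.
  apply: eq_bigr => m _; rewrite rmorphM /= rat_subst_C.
  rewrite -mul_mpolyC tofracM; congr (_ * _).
  rewrite /mmap1 mpolyXE_id !rmorph_prod; apply: eq_bigr => j _.
  rewrite !rmorphXn /=; congr (_ ^+ _).
  rewrite [X in rat_subst _ X = _]/sigma_pt.
  have [->|ji] := eqVneq j i.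
    by rewrite fmorphV /= rat_subst_X /sigma_pt eqxx invrK.
  rewrite rmorphM rmorphXn /= !rat_subst_X /sigma_pt eqxx (negbTE ji).
  by rewrite exprVn mulfK // expf_neq0 ?ratX_neq0.
move=> f; rewrite -[in RHS](frac_repr f) -(polyK \n_(repr f)).
by rewrite -(polyK \d_(repr f)) -fmorph_div.
Qed.

Lemma one_sub_ratCX_neq0 u i : 1 - ratC u * ratX i != 0.
Proof.
rewrite /ratC /ratX -tofrac1 -tofracM -tofracB tofrac_eq0.
apply/eqP => /(congr1 (mcoeff 0)); rewrite mcoeffB mcoeff1 mcoeff0 mcoeffCM.
by rewrite mcoeffX mnm1_eq0 mulr0 subr0 eqxx => /eqP; rewrite oner_eq0.
Qed.

Lemma one_sub_ratCV_neq0 u i : 1 - ratC u / ratX i != 0.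
Proof.
have X0 := ratX_neq0 i; rewrite -(mulfV X0) -mulrBl mulf_neq0 ?invr_eq0 //.
rewrite -tofracB tofrac_eq0; apply/eqP => /(congr1 (mcoeff U_(i))).
rewrite mcoeffB mcoeffX mcoeffC mcoeff0 eqxx mnm1_eq0 mulr0 subr0.
by move/eqP; rewrite oner_eq0.
Qed.

Lemma rat_subst_Xi i : rat_subst (sigma_pt i) (ratX i) = (ratX i)^-1.
Proof. by rewrite rat_subst_X /sigma_pt eqxx. Qed.

Lemma cg_genK u i : involutive (cg_gen u i).
Proof.
move=> f; rewrite /cg_gen rmorphM /= rat_substK fmorph_div /= !rmorphB /=.
rewrite rmorph1 fmorph_div rmorphM /= rat_subst_C rat_subst_Xi invrK mulrA.
rewrite mulf_div [X in X / _]mulrC divff ?mul1r //.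
by rewrite mulf_neq0 ?one_sub_ratCX_neq0 ?one_sub_ratCV_neq0.
Qed.

Lemma cg0_genK u i : involutive (cg0_gen u i).
Proof.
move=> f; have X0 := expf_neq0 2 (ratX_neq0 i).
have cgZ g h : cg_gen u i (g * h) = rat_subst (sigma_pt i) g * cg_gen u i h.
  by rewrite /cg_gen rmorphM mulrCA.
rewrite /cg0_gen cgZ rmorphN rmorphXn /= rat_subst_Xi cg_genK.
by rewrite exprVn mulrA mulrNN divff // mul1r.
Qed.

Lemma cg_act1 u w f : sval w = 1 -> cg_act u w f = f.
Proof. exact/weyl_act1/cg_genK. Qed.
Lemma cg_actG u w i f : sval w = refl i -> cg_act u w f = cg_gen u i f.
Proof. exact/weyl_actG/cg_genK. Qed.
Lemma cg_actM u w w1 w2 f : sval w = sval w1 * sval w2 ->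
  cg_act u w f = cg_act u w2 (cg_act u w1 f).
Proof. exact/weyl_actM/cg_genK. Qed.

Lemma cg0_act1 u w f : sval w = 1 -> cg0_act u w f = f.
Proof. exact/weyl_act1/cg0_genK. Qed.
Lemma cg0_actG u w i f : sval w = refl i -> cg0_act u w f = cg0_gen u i f.
Proof. exact/weyl_actG/cg0_genK. Qed.
Lemma cg0_actM u w w1 w2 f : sval w = sval w1 * sval w2 ->
  cg0_act u w f = cg0_act u w2 (cg0_act u w1 f).
Proof. exact/weyl_actM/cg0_genK. Qed.

End Rational.

Definition alpha (i : 'I_2) : 'X_{1..2} := U_(i)%MM.
Definition delta : 'X_{1..2} := (alpha ord0 + alpha ord_max)%MM.
Definition real_root (i : 'I_2) (k : nat) : 'X_{1..2} :=
  (alpha i + delta *+ k)%MM.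

Section Z0.
Context {R : idomainType}.

Local Notation K := {fraction {mpoly R[2]}}.
Local Notation "x %:F" := (@tofrac _ x).

Definition expands (f : K) (g : fps 2 R) : Prop := exists p q : {mpoly R[2]},
  [/\ q%:S \is a GRing.unit, f = p%:F / q%:F & g = p%:S / q%:S].

(* The power series expansion at the origin; [0] if there is none over [R]. *)
Definition expansion (f : K) : fps 2 R := xget 0 (expands f).

Definition Delta : fps 2 R :=
  fps_prod (fun k => \prod_(i < 2) (1 - 'X_[real_root i k *+ 2])%:S) *
  fps_prod (fun k => (1 - 'X_[delta *+ (2 * k.+1)])%:S).

Definition weyl_sum (u : R) : fps 2 R :=
  fps_sum (fun w : weyl => expansion (cg0_act u w 1)).

(* Coefficients stay in [R]: taking [R := {poly int}] and [u := 'X] gives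
   coefficients polynomial in an indeterminate [u]. *)
Definition Z0 (u : R) : fps 2 R := Delta^-1 * weyl_sum u.

Lemma expands_unique f g h : expands f g -> expands f h -> g = h.
Proof.
move=> [p [q [qu fE ->]]] [r [s [su fE' ->]]].
have n0 (t : {mpoly R[2]}) : t%:S \is a GRing.unit -> t != 0.
  by apply: contraTneq => ->; rewrite rmorph0 unitr0.
have /eqP : p%:F / q%:F = r%:F / s%:F by rewrite -fE.
rewrite eqr_div ?tofrac_eq0 ?n0 // -!tofracM tofrac_eq => /eqP e.
apply: (canLR (mulrK qu)); rewrite mulrAC; apply: (canRL (mulrK su)).
by rewrite -!rmorphM e.
Qed.

Lemma expansionE f g : expands f g -> expansion f = g.
Proof.
by move=> fg; apply: xget_unique => // h fh; apply: expands_unique fh fg.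
Qed.

Lemma one_sub_X_low (l m : 'X_{1..2}) : (mdeg m < mdeg l)%N ->
  fcoef (1 - 'X_[l])%:S m = (m == 0%MM)%:R :> R.
Proof.
move=> ml; rewrite /= mcoeffB mcoeff1 mcoeffX.
by case: (l =P m) ml => [->|_]; rewrite ?ltnn // subr0.
Qed.

Lemma mdeg_delta : mdeg delta = 2.
Proof. by rewrite mdegD !mdeg1. Qed.

Lemma mdeg_real_root i k : mdeg (real_root i k) = (1 + 2 * k)%N.
Proof. by rewrite mdegD mdeg1 mdegMn mdeg_delta. Qed.

Lemma real_factor_low k m : (mdeg m < k)%N ->
  fcoef (\prod_(i < 2) (1 - 'X_[real_root i k *+ 2])%:S : fps 2 R) m =
  (m == 0%MM)%:R.
Proof.
move=> mk; rewrite !big_ord_recl big_ord0 mulr1 fcoefM_low => [|l lm];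
  by apply: one_sub_X_low; rewrite mdegMn mdeg_real_root; lia.
Qed.

Lemma imaginary_factor_low k m : (mdeg m < k)%N ->
  fcoef (1 - 'X_[delta *+ (2 * k.+1)])%:S m = (m == 0%MM)%:R :> R.
Proof.
by move=> mk; apply: one_sub_X_low; rewrite mdegMn mdeg_delta; lia.
Qed.

Lemma fcoefM0 (f g : fps 2 R) :
  fcoef (f * g) 0%MM = fcoef f 0%MM * fcoef g 0%MM.
Proof.
rewrite (@fcoef_mul _ _ _ _ (fcoef f 0%MM)%:MP (fcoef g 0%MM)%:MP).
- by rewrite mcoeffCM mcoeffC eqxx mulr1.
- by move=> k; rewrite mdeg0 leqn0 mdeg_eq0 => /eqP->; rewrite mcoeffC eqxx mulr1.
- by move=> k; rewrite mdeg0 leqn0 mdeg_eq0 => /eqP->; rewrite mcoeffC eqxx mulr1.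
Qed.

Lemma fcoef_prod0 (F : nat -> fps 2 R) :
  (forall k m, (mdeg m < k)%N -> fcoef (F k) m = (m == 0%MM)%:R) ->
  (forall k, fcoef (F k) 0%MM = 1) -> fcoef (fps_prod F) 0%MM = 1.
Proof.
move=> /fps_prod_cvg/(_ 0%MM)[N HN] F0; rewrite -(HN N (leqnn N)).
elim: N {HN} => [|N IHN]; first by rewrite big_ord0 fcoef1 eqxx.
by rewrite big_ord_recr fcoefM0 IHN F0 mulr1.
Qed.

Lemma Delta_unit : Delta \is a GRing.unit.
Proof.
have X0 (l : 'X_{1..2}) : (0 < mdeg l)%N -> fcoef (1 - 'X_[l])%:S 0%MM = 1 :> R.
  by move=> l0; rewrite one_sub_X_low ?mdeg0 // eqxx.
apply: fps_unit1; rewrite fcoefM0 !fcoef_prod0 ?mulr1 //.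
- exact: imaginary_factor_low.
- by move=> k; apply: X0; rewrite mdegMn mdeg_delta.
- exact: real_factor_low.
- move=> k; rewrite !big_ord_recl big_ord0 mulr1 fcoefM0.
  by rewrite !X0 ?mulr1 // mdegMn mdeg_real_root; lia.
Qed.

Lemma qpoch_low (a p : fps 2 R) k m : fcoef p 0%MM = 0 -> (mdeg m < k)%N ->
  fcoef (1 - a * p ^+ k) m = (m == 0%MM)%:R.
Proof.
move=> p0 mk; rewrite fcoefB fcoef1 fcoefM big1 ?subr0 // => -[l1 l2] _ /=.
by rewrite fcoef_expr_low ?mulr0 //; apply: leq_ltn_trans mk; rewrite -ltnS bmdeg.
Qed.

Lemma qpoch_cvg (a p : fps 2 R) : fcoef p 0%MM = 0 ->
  fps_cvg (fun N => \prod_(k < N) (1 - a * p ^+ k)) (qpoch a p).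
Proof. by move=> p0; apply: fps_prod_cvg => k m; apply: qpoch_low. Qed.

Lemma qpoch_unit (a p : fps 2 R) : fcoef p 0%MM = 0 -> fcoef a 0%MM = 0 ->
  qpoch a p \is a GRing.unit.
Proof.
move=> p0 a0; apply/fps_unit1/fcoef_prod0 => k; first by move=> m; apply: qpoch_low.
by rewrite fcoefB fcoefM0 a0 mul0r subr0 fcoef1 eqxx.
Qed.

End Z0.

Arguments Delta R : clear implicits.

(* Main.v *)
(* Write [d = x^delta], [x = x_0], [y = x_1] and
     t_n(u, v; y) =
       prod_(k < n) - (u - y d^k) (v - y d^k) / ((1 - u y d^k) (1 - v y d^k)).
   For [sigma] of length [n > 0] the term [1 |_0 sigma] is [t_n(u, 0; x_i)], with
   [sigma_i] the last letter of [sigma], so the sum over [W] is [S(u, 0)], where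
   [S(u, v) = 1 + sum_(n > 0) (t_n(u, v; y) + t_n(u, v; x))] is a bilateral basic
   hypergeometric series. A telescoping (WZ) certificate gives
     (1 - u x) (1 - u y) (1 + u v) S(u, v) = (1 - u^2 d) (1 - u v) S(u d, v),
   and iterating it expresses [S(u, v)] through [S(0, v)] by infinite products.
   Hence everything is known up to the factor [S(0, 0)], and that factor follows
   from [S(y, x) = 1], where the series terminates on both sides, by the chain
   [S(y, x) -> S(0, x) = S(x, 0) -> S(0, 0)]. It is equal to [Delta]. *)
Require Import Defs.
From mathcomp Require Import all_boot all_order all_algebra.
From mathcomp Require Import boolp classical_sets functions cardinality fsbigop.
From mathcomp Require Import mpoly.
From mathcomp Require Import zify ring.

Set Implicit Arguments.
Unset Strict Implicit.
Unset Printing Implicit Defensive.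

Import GRing.Theory.
Local Open Scope ring_scope.

(** * Finite bilateral sums and the telescoping shift [u -> u d] *)

Section Telescope.
Context {A : comUnitRingType}.
Implicit Types (x y u v d w : A).

Definition bfactor u v w : A :=
  - ((u - w) * (v - w)) / ((1 - u * w) * (1 - v * w)).

Definition bterm d u v y n : A := \prod_(k < n) bfactor u v (y * d ^+ k).

Definition bsum d u v x y N : A :=
  1 + \sum_(n < N) bterm d u v y n.+1 + \sum_(n < N) bterm d u v x n.+1.

Lemma btermS d u v y n :
  bterm d u v y n.+1 = bterm d u v y n * bfactor u v (y * d ^+ n).
Proof. by rewrite /bterm big_ord_recr. Qed.

Lemma bsumS d u v x y N : bsum d u v x y N.+1 =
  bsum d u v x y N + (bterm d u v y N.+1 + bterm d u v x N.+1).
Proof. by rewrite /bsum !big_ord_recr /= [1 + (_ + _)]addrA addrACA. Qed.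

Lemma bfactorC u v w : bfactor u v w = bfactor v u w.
Proof. by rewrite /bfactor [(u - w) * _]mulrC [(1 - u * w) * _]mulrC. Qed.

Lemma bsumC d u v x y N : bsum d u v x y N = bsum d v u x y N.
Proof.
by rewrite /bsum; congr (_ + _ + _); apply: eq_bigr => n _;
  apply: eq_bigr => k _; rewrite bfactorC.
Qed.

(** In each half the [k = 0] factor already vanishes: [u - y = 0] in the [y] half, [v - x = 0] in
    the [x] half. Only the leading 1 survives. *)
Lemma bsum_terminating d x y N : bsum d y x x y N = 1.
Proof.
have b0 z n : bfactor y x z = 0 -> bterm d y x z n.+1 = 0.
  by move=> z0; rewrite /bterm big_ord_recl expr0 mulr1 z0 mul0r.
rewrite /bsum !big1 ?addr0 // => n _; apply: b0;
  by rewrite /bfactor subrr ?(mulr0, mul0r) oppr0 mul0r.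
Qed.

(** Iterates a one-step recurrence; the products stay on both sides, so that nothing has to be
    inverted. *)
Lemma prod_shift (a b c e f F : nat -> A) N :
  (forall k, a k * b k * c k * F k = e k * f k * F k.+1) ->
  \prod_(k < N) a k * \prod_(k < N) b k * \prod_(k < N) c k * F 0 =
  \prod_(k < N) e k * \prod_(k < N) f k * F N.
Proof.
move=> step; rewrite -!big_split /=.
elim: N => [|N IHN]; first by rewrite !big_ord0.
rewrite !big_ord_recr /= [LHS]mulrAC IHN -[LHS]mulrA [F N * _]mulrC step.
by rewrite [LHS]mulrA.
Qed.

Section Shift.
Context (x y u v : A).
Let d := x * y.
Context (uU : forall k, 1 - u * (y * d ^+ k) \is a GRing.unit).
Context (vU : forall k, 1 - v * (y * d ^+ k) \is a GRing.unit).
Let C := (1 - u * x) * (1 - u * y).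

Lemma bfactorE w : 1 - u * w \is a GRing.unit -> 1 - v * w \is a GRing.unit ->
  bfactor u v w * ((1 - u * w) * (1 - v * w)) = - ((u - w) * (v - w)).
Proof. by move=> a b; rewrite divrK // unitrM a. Qed.

(** Replacing [u] by [u d] moves each [u]-factor one index along: [u d - y d^k = d (u - y d^(k-1))],
    and [1 - u d y d^k] is the old denominator at [k + 1]. The odd factor at [k = 0] is
    [u d - y = - y (1 - u x)], because [d = x y]; it supplies the [1 - u x] of [C]. *)
Lemma bterm_shift n (w := y * d ^+ n) :
  bterm d (u * d) v y n.+1 * ((1 - u * w) * (1 - u * (w * d)) * (1 - v * w)) =
  C * w * (v - w) * bterm d u v y n.
Proof.
rewrite {}/w; elim: n => [|n IHn].
  have := uU 1; have := vU 0; rewrite /bterm big_ord_recl !big_ord0.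
  rewrite expr0 expr1 /bfactor !mulr1 => v0 u1.
  have -> : u * d * y = u * (y * d) by ring.
  have -> : (1 - u * y) * (1 - u * (y * d)) * (1 - v * y) =
    ((1 - u * (y * d)) * (1 - v * y)) * (1 - u * y) by ring.
  by rewrite [LHS]mulrA divrK ?unitrM ?u1 // /C /d; ring.
rewrite btermS [in RHS]btermS.
have := uU n; have := vU n; have := vU n.+1; have := uU n.+2.
have wS k : y * d ^+ k.+1 = y * d ^+ k * d by rewrite exprSr mulrA.
rewrite !wS; move: IHn; set w := y * d ^+ n.
set T' := bterm _ _ _ _ _; set T := bterm _ _ _ _ _ => IHn b'U c'U cU aU.
have ac : (1 - u * w) * (1 - v * w) \is a GRing.unit by rewrite unitrM aU.
have uwE : u * d * (w * d) = u * (w * d * d) by ring.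
have F' : bfactor (u * d) v (w * d) * ((1 - u * (w * d * d)) * (1 - v * (w * d))) =
    - ((u * d - w * d) * (v - w * d)).
  by rewrite /bfactor uwE divrK // unitrM b'U.
apply: (mulIr ac).
transitivity (T' * ((1 - u * w) * (1 - u * (w * d)) * (1 - v * w)) *
  (bfactor (u * d) v (w * d) * ((1 - u * (w * d * d)) * (1 - v * (w * d))))).
  by ring.
transitivity (C * (w * d) * (v - w * d) * T *
  (bfactor u v w * ((1 - u * w) * (1 - v * w)))); last by ring.
by rewrite IHn F' bfactorE //; ring.
Qed.

(** The telescoping certificate, a rational multiple of the [n]-th term; its differences are
    computed in [bterm_cert]. *)
Definition cert n : A :=
  u * C * (v - y * d ^+ n) * bterm d u v y n / (1 - u * (y * d ^+ n)).

(** All four terms are rational multiples of [bterm d u v y n], by [btermS] and [bterm_shift].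
    Clearing the denominators leaves a polynomial identity. *)
Lemma bterm_cert n :
  C * (1 + u * v) * bterm d u v y n.+1 -
  (1 - u ^+ 2 * d) * (1 - u * v) * bterm d (u * d) v y n.+1 =
  cert n.+1 - cert n.
Proof.
have := bterm_shift n; rewrite /cert (btermS d u v); have := uU n; have := vU n.
have := uU n.+1; rewrite (_ : y * d ^+ n.+1 = y * d ^+ n * d);
  last by rewrite exprSr mulrA.
set w := y * d ^+ n.
set T' := bterm _ _ _ _ _; set T := bterm _ _ _ _ _ => bU cU aU T'E.
have U : (1 - u * w) * (1 - u * (w * d)) * (1 - v * w) \is a GRing.unit.
  by rewrite !unitrM aU bU.
set f := bfactor u v w; have fE : f * _ = _ := bfactorE aU cU.
set a := 1 - u * w in aU fE T'E U *; set b := 1 - u * (w * d) in bU T'E U *.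
set c := 1 - v * w in cU fE T'E U *.
apply: (mulIr U); rewrite mulrBl.
(* Both sides are regrouped so that [fE], [T'E] and the inverses apply to visible subterms before
   [ring]. *)
transitivity (C * (1 + u * v) * T * b * (f * (a * c)) -
  (1 - u ^+ 2 * d) * (1 - u * v) * (T' * (a * b * c))); first by ring.
transitivity (u * C * (v - w * d) * T * (f * (a * c)) * (b^-1 * b) -
  u * C * (v - w) * T * b * c * (a^-1 * a)); last by ring.
by rewrite T'E fE !mulVr // /a /b /c; ring.
Qed.

Lemma bterm_sum_cert N :
  C * (1 + u * v) * (\sum_(n < N) bterm d u v y n.+1) -
  (1 - u ^+ 2 * d) * (1 - u * v) * (\sum_(n < N) bterm d (u * d) v y n.+1) =
  cert N - u * (1 - u * x) * (v - y).
Proof.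
have c0 : cert 0 = u * (1 - u * x) * (v - y).
  have := uU 0; rewrite /cert /bterm big_ord0 expr0 !mulr1 /C => U.
  by apply: (mulIr U); rewrite divrK //; ring.
rewrite -c0 -(telescope_sumr cert (leq0n N)) big_mkord !mulr_sumr -sumrB.
by apply: eq_bigr => n _; rewrite bterm_cert.
Qed.

End Shift.

Lemma bsum_shift x y u v N (d := x * y) :
  (forall k, 1 - u * (x * d ^+ k) \is a GRing.unit) ->
  (forall k, 1 - u * (y * d ^+ k) \is a GRing.unit) ->
  (forall k, 1 - v * (x * d ^+ k) \is a GRing.unit) ->
  (forall k, 1 - v * (y * d ^+ k) \is a GRing.unit) ->
  (1 - u * x) * (1 - u * y) * (1 + u * v) * bsum d u v x y N -
  (1 - u ^+ 2 * d) * (1 - u * v) * bsum d (u * d) v x y N =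
  cert x y u v N + cert y x u v N.
Proof.
move=> ux uy vx vy; have Ey := bterm_sum_cert uy vy N.
(* The [x] half is the [y] half with [x] and [y] exchanged, which fixes [d]. *)
have := @bterm_sum_cert y x u v; rewrite [y * x]mulrC => /(_ ux vx N) Ex.
move: Ex Ey; rewrite -/d /bsum.
set sx := \sum_(n < N) _; set sx' := \sum_(n < N) _.
set sy := \sum_(n < N) _; set sy' := \sum_(n < N) _ => Ex Ey.
move: (cert y x u v N) (cert x y u v N) Ex Ey => cx cy Ex Ey.
have {}Ex := canRL (subrK _) (esym Ex).
have {}Ey := canRL (subrK _) (esym Ey).
(* The leading 1 of both sums absorbs the boundary values: [C (1 + u v) - (1 - u^2 d) (1 - u v) = u
   (1 - u x) (v - y) + u (1 - u y) (v - x)], where [C = (1 - u x) (1 - u y)]. *)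
by rewrite Ex Ey /d; ring.
Qed.

End Telescope.

(** * Congruence of power series up to a given degree, and infinite products *)

Section Congruence.
Context {n : nat} {R : comNzRingType}.
Implicit Types (f g a b p : fps n R) (k l N : nat).

(** Congruence modulo the [k]-th power of the ideal of the variables; limits are handled by working
    modulo every such power. *)
Definition fps_cong k f g :=
  forall m, (mdeg m < k)%N -> fcoef f m = fcoef g m.

Lemma fps_cong_refl k f : fps_cong k f f.
Proof. by []. Qed.

Lemma fps_cong_sym k f g : fps_cong k f g -> fps_cong k g f.
Proof. by move=> fg m mk; rewrite fg. Qed.

Lemma fps_cong_trans k g f h :
  fps_cong k f g -> fps_cong k g h -> fps_cong k f h.
Proof. by move=> fg gh m mk; rewrite fg ?gh. Qed.

Lemma fps_cong_leq l k f g : (k <= l)%N -> fps_cong l f g -> fps_cong k f g.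
Proof. by move=> kl fg m mk; apply: fg; apply: leq_trans mk kl. Qed.

Lemma fps_cong_eq f g : (forall k, fps_cong k f g) -> f = g.
Proof. by move=> fg; apply/fpsP => m; apply: (fg (mdeg m).+1). Qed.

Lemma fps_congD k f g a b :
  fps_cong k f g -> fps_cong k a b -> fps_cong k (f + a) (g + b).
Proof. by move=> fg ab m mk /=; rewrite fg ?ab. Qed.

Lemma fps_congN k f g : fps_cong k f g -> fps_cong k (- f) (- g).
Proof. by move=> fg m mk /=; rewrite fg. Qed.

Lemma fps_congB k f g a b :
  fps_cong k f g -> fps_cong k a b -> fps_cong k (f - a) (g - b).
Proof. by move=> fg ab; apply: fps_congD => //; apply: fps_congN. Qed.

Lemma fps_congM k f g a b :
  fps_cong k f g -> fps_cong k a b -> fps_cong k (f * a) (g * b).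
Proof.
move=> fg ab m mk; rewrite !fcoefM; apply: eq_bigr => -[k1 k2] _ /=.
by rewrite fg ?ab //; apply: leq_ltn_trans mk; rewrite -ltnS bmdeg.
Qed.

Lemma fps_cong_sum k (I : Type) (r : seq I) (F G : I -> fps n R) :
  (forall i, fps_cong k (F i) (G i)) ->
  fps_cong k (\sum_(i <- r) F i) (\sum_(i <- r) G i).
Proof. by move=> FG; apply: (big_rec2 (fps_cong k)) => // i a b _; apply: fps_congD. Qed.

Lemma fps_cong_prod k (I : Type) (r : seq I) (F G : I -> fps n R) :
  (forall i, fps_cong k (F i) (G i)) ->
  fps_cong k (\prod_(i <- r) F i) (\prod_(i <- r) G i).
Proof. by move=> FG; apply: (big_rec2 (fps_cong k)) => // i a b _; apply: fps_congM. Qed.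

(** The inverses are [f^-1 g g^-1] and [f^-1 f g^-1], which differ only in the middle factor. *)
Lemma fps_congV k f g : f \is a GRing.unit -> g \is a GRing.unit ->
  fps_cong k f g -> fps_cong k f^-1 g^-1.
Proof.
move=> fU gU fg; rewrite -[f^-1](mulrK gU) -[X in fps_cong k _ X](mulKr fU).
rewrite -mulrA.
by apply: fps_congM => //; apply: fps_congM => //; apply: fps_cong_sym.
Qed.

Lemma fps_congM0 k l f g :
  fps_cong k f 0 -> fps_cong l g 0 -> fps_cong (k + l) (f * g) 0.
Proof.
move=> f0 g0 m mkl; rewrite fcoefM fcoef0 big1 // => -[k1 k2] /eqP /= mE.
have dE : mdeg m = (mdeg k1 + mdeg k2)%N by rewrite -mdegD; apply: congr1 mE.
have [k1k|k1k] := ltnP (mdeg k1) k; first by rewrite f0 ?fcoef0 ?mul0r.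
by rewrite g0 ?fcoef0 ?mulr0 //; rewrite dE in mkl; lia.
Qed.

Lemma fps_congMl0 k f g : fps_cong k f 0 -> fps_cong k (g * f) 0.
Proof. by move=> f0; rewrite -[0](mulr0 g); apply: fps_congM. Qed.

Lemma fps_congX0 k f : fps_cong 1 f 0 -> fps_cong k (f ^+ k) 0.
Proof.
move=> f0; elim: k => [|k IHk]; first by move=> m.
by rewrite exprS; apply: (fps_congM0 f0 IHk).
Qed.

Lemma fps_cong0_const f : fps_cong 1 f 0 <-> fcoef f 0%MM = 0.
Proof.
split=> [f0|f0 m]; first by rewrite f0 ?mdeg0 // fcoef0.
by rewrite ltnS leqn0 mdeg_eq0 => /eqP ->; rewrite f0 fcoef0.
Qed.

Lemma fps_unit_1B f : fps_cong 1 f 0 -> 1 - f \is a GRing.unit.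
Proof.
move=> f0; apply: fps_unit1.
by rewrite fcoefB (f0 0%MM) ?mdeg0 // fcoef0 subr0 fcoef1 eqxx.
Qed.

(** Factors of index at least [N] are 1 modulo degree [N], so the partial products have stabilised
    from [N] factors on. *)
Lemma fps_prod_cong (F : nat -> fps n R) N M :
  (forall k, fps_cong k (F k) 1) -> (N <= M)%N ->
  fps_cong N (fps_prod F) (\prod_(k < M) F k).
Proof.
move=> F1 NM m mN.
have [|K FK] := @fps_prod_cvg n R F _ m; first by move=> k l /F1->; rewrite fcoef1.
have step L : (N <= L)%N -> fcoef (\prod_(k < L) F k) m = fcoef (\prod_(k < N) F k) m.
  elim: L => [|L IHL]; first by rewrite leqn0 => /eqP ->.
  rewrite leq_eqVlt ltnS => /predU1P[->//|NL]; rewrite -(IHL NL) big_ord_recr /=.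
  rewrite -[in RHS](mulr1 (\prod_(k < L) F k)).
  by apply: (@fps_congM N _ _ _ _ _ _ m mN) => //; apply: fps_cong_leq NL (F1 L).
by rewrite -(FK (maxn K N)) ?leq_maxl // !step // leq_maxr.
Qed.

Lemma fps_prod_eq (F : nat -> fps n R) g : (forall k, fps_cong k (F k) 1) ->
  (forall N, fps_cong N (\prod_(k < N) F k) g) -> fps_prod F = g.
Proof.
by move=> F1 Fg; apply: fps_cong_eq => N; apply: fps_cong_trans (Fg N);
  apply: fps_prod_cong.
Qed.

Lemma qpoch_factor_cong a p k : fps_cong 1 p 0 ->
  fps_cong k (1 - a * p ^+ k) 1.
Proof.
move=> p0; rewrite -[X in fps_cong _ _ X]subr0.
by apply: fps_congB => //; apply/fps_congMl0/fps_congX0.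
Qed.

Lemma qpoch_cong a p N M : fps_cong 1 p 0 -> (N <= M)%N ->
  fps_cong N (qpoch a p) (\prod_(k < M) (1 - a * p ^+ k)).
Proof. by move=> p0; apply: fps_prod_cong => k; apply: qpoch_factor_cong. Qed.

(** Difference of squares, factor by factor. *)
Lemma qpochM a p : fps_cong 1 p 0 ->
  qpoch a p * qpoch (- a) p = qpoch (a ^+ 2) (p ^+ 2).
Proof.
move=> p0; apply: fps_cong_eq => N.
have p20 : fps_cong 1 (p ^+ 2) 0 by rewrite expr2; apply: fps_congMl0.
apply: fps_cong_trans (fps_congM (qpoch_cong _ p0 (leqnn N))
  (qpoch_cong _ p0 (leqnn N))) _.
apply: fps_cong_trans (fps_cong_sym (qpoch_cong _ p20 (leqnn N))).
by rewrite -big_split /=; under eq_bigr => k _ do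
  rewrite mulNr opprK -subr_sqr expr1n exprMn exprAC.
Qed.

Lemma qpoch_split a p : fps_cong 1 p 0 ->
  qpoch a p = qpoch a (p ^+ 2) * qpoch (a * p) (p ^+ 2).
Proof.
move=> p0; apply: fps_cong_eq => N.
have p20 : fps_cong 1 (p ^+ 2) 0 by rewrite expr2; apply: fps_congMl0.
(* Taking [2 N] factors on the left matches exactly [N] of even and [N] of odd index on the
   right. *)
apply: fps_cong_trans (qpoch_cong _ p0 (leq_addr N N)) _.
apply: fps_cong_sym; apply: fps_cong_trans (fps_congM
  (qpoch_cong _ p20 (leqnn N)) (qpoch_cong _ p20 (leqnn N))) _.
rewrite addnn -big_split /=; set l := \prod_(k < N) _; set r := \prod_(k < _) _.
suff -> : l = r by [].
rewrite {}/l {}/r; elim: N => [|N IHN]; first by rewrite !big_ord0.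
rewrite doubleS !big_ord_recr /= IHN [LHS]mulrA -mul2n (exprS p (2 * N)) exprM.
by rewrite [a * (p * _)]mulrA.
Qed.

End Congruence.

(** * The bilateral series and its evaluation by infinite products *)

Section Bilateral.
Context {n : nat} {R : comNzRingType}.
Implicit Types (x y u v w d : fps n R).

Lemma qpoch_unit1 (a p : fps n R) : fps_cong 1 p 0 -> fps_cong 1 a 0 ->
  qpoch a p \is a GRing.unit.
Proof.
move=> p0 a0; apply: fps_unit1; have := @qpoch_cong _ _ a _ 1 1 p0 (leqnn _).
rewrite big_ord1 expr0 mulr1 => ->; rewrite ?mdeg0 //.
by rewrite fcoefB (a0 0%MM) ?mdeg0 // fcoef0 subr0 fcoef1 eqxx.
Qed.

Lemma qpoch0 (p : fps n R) : fps_cong 1 p 0 -> qpoch 0 p = 1.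
Proof.
move=> p0; apply: fps_cong_eq => N.
apply: fps_cong_trans (qpoch_cong _ p0 (leqnn N)) _.
by rewrite big1 // => k _; rewrite mul0r subr0.
Qed.

(* The limit of [bsum] provided that [u * v] has no constant term: the order of
   [bterm d u v y N] is then at least [N]. Otherwise a junk value. *)
Definition bseries d u v x y : fps n R :=
  Fps (fun m => fcoef (bsum d u v x y (mdeg m).+1) m).

Lemma fcoef_bseries d u v x y m :
  fcoef (bseries d u v x y) m = fcoef (bsum d u v x y (mdeg m).+1) m.
Proof. by []. Qed.

Local Opaque fps_of_mpoly fps_mul fps_add fps_opp fps_inv qpoch bseries.

Lemma bseriesC d u v x y : bseries d u v x y = bseries d v u x y.
Proof.
by apply/fpsP => m; apply: (congr1 (fun f => fcoef f m) (bsumC d u v x y _)).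
Qed.

Lemma bfactor_cong k u u' v v' w : fps_cong 1 w 0 ->
  fps_cong k u u' -> fps_cong k v v' ->
  fps_cong k (bfactor u v w) (bfactor u' v' w).
Proof.
move=> w0 uu vv; have U a : 1 - a * w \is a GRing.unit.
  exact/fps_unit_1B/fps_congMl0.
apply: fps_congM; first by apply/fps_congN/fps_congM; apply: fps_congB.
apply: fps_congV; rewrite ?unitrM ?U //.
by apply: fps_congM; apply: fps_congB => //; apply: fps_congM.
Qed.

Lemma bfactor_cong0 u v w : fps_cong 1 w 0 -> fps_cong 1 (u * v) 0 ->
  fps_cong 1 (bfactor u v w) 0.
Proof.
move=> w0 uv0; rewrite /bfactor mulrC.
(* The numerator is [- u v] modulo [w], and both have zero constant term. *)
have -> : - ((u - w) * (v - w)) = (u + v - w) * w - u * v by ring.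
apply: fps_congMl0; rewrite -[0]subr0.
by apply: fps_congB => //; apply: fps_congMl0.
Qed.

Section Point.
Context (x y : fps n R) (x0 : fps_cong 1 x 0) (y0 : fps_cong 1 y 0).
Let d := x * y.

Let d0 : fps_cong 1 d 0.
Proof. exact: fps_congMl0. Qed.

Let root0 z k : fps_cong 1 z 0 -> fps_cong 1 (z * d ^+ k) 0.
Proof. by move=> z0; rewrite mulrC; apply: fps_congMl0. Qed.

Let rootU u z k : fps_cong 1 z 0 -> 1 - u * (z * d ^+ k) \is a GRing.unit.
Proof. by move=> z0; apply/fps_unit_1B/fps_congMl0/root0. Qed.

Lemma bterm_cong0 u v z N : fps_cong 1 z 0 -> fps_cong 1 (u * v) 0 ->
  fps_cong N (bterm d u v z N) 0.
Proof.
move=> z0 uv0; elim: N => [|N IHN]; first by move=> m.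
rewrite btermS -addn1; apply: fps_congM0 => //.
exact: bfactor_cong0 (root0 _ z0) uv0.
Qed.

Lemma bsum_cong u v N M : fps_cong 1 (u * v) 0 -> (N <= M)%N ->
  fps_cong N (bsum d u v x y M) (bsum d u v x y N).
Proof.
move=> uv0 /subnK <-; elim: (M - N)%N => [|K IHK].
  by rewrite add0n; apply: fps_cong_refl.
have t0 z : fps_cong 1 z 0 -> fps_cong N (bterm d u v z (K + N).+1) 0.
  move=> z0; apply: (@fps_cong_leq _ _ (K + N).+1); first by lia.
  exact: bterm_cong0.
rewrite addSn bsumS -[bsum d u v x y N]addr0; apply: fps_congD IHK _.
by rewrite -[0]addr0; apply: fps_congD; apply: t0.
Qed.

Lemma bseries_cong u v N : fps_cong 1 (u * v) 0 ->
  fps_cong N (bseries d u v x y) (bsum d u v x y N).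
Proof. by move=> uv0 m mN; rewrite fcoef_bseries (bsum_cong uv0 mN). Qed.

(** Continuity in [u]; it allows [u d^N] to be replaced by 0 in [bseries_qpoch]. *)
Lemma bseries_congl u u' v N : fps_cong 1 (u * v) 0 -> fps_cong 1 (u' * v) 0 ->
  fps_cong N u u' -> fps_cong N (bseries d u v x y) (bseries d u' v x y).
Proof.
move=> uv0 uv0' uu; apply: fps_cong_trans (bseries_cong uv0) _.
apply: fps_cong_sym; apply: fps_cong_trans (bseries_cong uv0') _.
have tt z M : fps_cong 1 z 0 -> fps_cong N (bterm d u' v z M) (bterm d u v z M).
  move=> z0; apply: fps_cong_prod => k; apply: bfactor_cong => //.
  - exact: root0.
  - exact: fps_cong_sym.
rewrite /bsum; apply: fps_congD; [apply: fps_congD (fps_cong_refl _) _|].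
  by apply: fps_cong_sum => k; apply: tt.
by apply: fps_cong_sum => k; apply: tt.
Qed.

(** The certificate carries a term of order at least [N], so the right-hand side of [bsum_shift]
    disappears in the limit. *)
Lemma cert_cong0 u v z z' N : fps_cong 1 z' 0 -> z * z' = d ->
  fps_cong 1 (u * v) 0 -> fps_cong N (cert z z' u v N) 0.
Proof.
move=> z0 zd uv0; rewrite /cert mulrAC zd.
exact/fps_congMl0/bterm_cong0.
Qed.

Lemma bseries_shift u v : fps_cong 1 (u * v) 0 ->
  (1 - u * x) * (1 - u * y) * (1 + u * v) * bseries d u v x y =
  (1 - u ^+ 2 * d) * (1 - u * v) * bseries d (u * d) v x y.
Proof.
move=> uv0; apply/eqP; rewrite -subr_eq0; apply/eqP/fps_cong_eq => N.
have udv0 : fps_cong 1 (u * d * v) 0 by rewrite mulrAC; apply: fps_congMl0.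
apply: fps_cong_trans (_ : fps_cong N _ (cert x y u v N + cert y x u v N)) _.
  rewrite -bsum_shift; try by move=> k; apply: rootU.
  by apply: fps_congB; apply: fps_congM => //; apply: bseries_cong.
by rewrite -[0]addr0; apply: fps_congD; apply: cert_cong0; rewrite // mulrC.
Qed.

Lemma bseries_shifts u v N : fps_cong 1 (u * v) 0 ->
  \prod_(k < N) (1 - u * x * d ^+ k) * \prod_(k < N) (1 - u * y * d ^+ k) *
  \prod_(k < N) (1 - - (u * v) * d ^+ k) * bseries d u v x y =
  \prod_(k < N) (1 - u ^+ 2 * d * (d ^+ 2) ^+ k) *
  \prod_(k < N) (1 - u * v * d ^+ k) * bseries d (u * d ^+ N) v x y.
Proof.
move=> uv0; have uE : u = u * d ^+ 0 by rewrite expr0 mulr1.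
rewrite [u in bseries d u v x y]uE.
apply: (@prod_shift _ (fun k => 1 - u * x * d ^+ k)
  (fun k => 1 - u * y * d ^+ k) (fun k => 1 - - (u * v) * d ^+ k)
  (fun k => 1 - u ^+ 2 * d * (d ^+ 2) ^+ k) (fun k => 1 - u * v * d ^+ k)
  (fun k => bseries d (u * d ^+ k) v x y) N) => k.
have ukv0 : fps_cong 1 (u * d ^+ k * v) 0.
  by rewrite mulrAC mulrC; apply: fps_congMl0.
have -> : u ^+ 2 * d * (d ^+ 2) ^+ k = (u * d ^+ k) ^+ 2 * d.
  by rewrite (exprMn 2 u) exprAC mulrAC.
have xE z : u * z * d ^+ k = u * d ^+ k * z by rewrite mulrAC.
rewrite mulNr opprK !xE (exprSr d k) [u * (_ * _)]mulrA; exact: bseries_shift.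
Qed.

Lemma bseries_qpoch u v : fps_cong 1 (u * v) 0 ->
  qpoch (u * x) d * qpoch (u * y) d * qpoch (- (u * v)) d * bseries d u v x y =
  qpoch (u ^+ 2 * d) (d ^+ 2) * qpoch (u * v) d * bseries d 0 v x y.
Proof.
move=> uv0; apply: fps_cong_eq => N.
have d20 : fps_cong 1 (d ^+ 2) 0 by rewrite expr2; apply: fps_congMl0.
have P (a p : fps n R) : fps_cong 1 p 0 ->
    fps_cong N (qpoch a p) (\prod_(k < N) (1 - a * p ^+ k)).
  by move=> p0; apply: qpoch_cong.
apply: fps_cong_trans (fps_congM (fps_congM (fps_congM (P _ _ d0) (P _ _ d0))
  (P _ _ d0)) (fps_cong_refl _)) _.
rewrite (bseries_shifts N uv0).
apply: fps_congM; last first.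
  apply: bseries_congl; rewrite ?mul0r //.
    by rewrite mulrAC mulrC; apply: fps_congMl0.
  exact/fps_congMl0/fps_congX0.
by apply: fps_cong_sym; apply: fps_congM; apply: P.
Qed.

Lemma bseries_v0 u :
  qpoch (u * x) d * qpoch (u * y) d * bseries d u 0 x y =
  qpoch (u ^+ 2 * d) (d ^+ 2) * bseries d 0 0 x y.
Proof.
have := @bseries_qpoch u 0; rewrite (mulr0 u) => /(_ (fps_cong_refl _)).
by rewrite oppr0 (qpoch0 d0) [X in X * bseries d u 0 x y]mulr1
  [X in X * bseries d 0 0 x y]mulr1.
Qed.

Lemma bseries00 :
  bseries d 0 0 x y =
  qpoch (x ^+ 2) (d ^+ 2) * qpoch (y ^+ 2) (d ^+ 2) * qpoch (d ^+ 2) (d ^+ 2).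
Proof.
have sq0 z : fps_cong 1 z 0 -> fps_cong 1 (z ^+ 2 * d) 0.
  by move=> z0; apply: fps_congMl0.
have d20 : fps_cong 1 (d ^+ 2) 0 by rewrite expr2; apply: fps_congMl0.
have yx0 : fps_cong 1 (y * x) 0 by apply: fps_congMl0.
have yxE : y * x = d by rewrite mulrC.
have cancel2 (A : comUnitRingType) (a b c e s : A) : a \is a GRing.unit ->
    c \is a GRing.unit -> a * (b * c) * e = c * a * s -> s = b * e.
  move=> aU cU E; apply: (mulrI aU); apply: (mulrI cU).
  by rewrite [c * (a * s)]mulrA -E; ring.
have cancel1 (A : comUnitRingType) (a b b' c e s : A) : c \is a GRing.unit ->
    b * c * a * (b' * e) = c * s -> s = b * b' * (a * e).
  by move=> cU E; apply: (mulrI cU); rewrite -E; ring.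
(* From [u = y], [v = x], where the series is 1 and [u v = d]. The product [(d; d)] cancels, and so
   does the odd half [(y^2 d; d^2)] of [(y^2; d)]. *)
have S0x : bseries d 0 x x y = qpoch (y ^+ 2) (d ^+ 2) * qpoch (- d) d.
  have := bseries_qpoch yx0; rewrite yxE -expr2.
  have -> : bseries d y x x y = 1.
    by apply/fpsP => m; rewrite fcoef_bseries bsum_terminating.
  rewrite (qpoch_split (y ^+ 2) d0) mulr1 => E.
  exact: cancel2 (qpoch_unit1 d0 d0) (qpoch_unit1 d20 (sq0 y y0)) E.
(* Now [u = x], [v = 0]: the odd half of [(x^2; d)] cancels, and [(d; d) (-d; d) = (d^2; d^2)]. *)
have := bseries_v0 x; rewrite bseriesC -(expr2 x).
rewrite S0x (qpoch_split (x ^+ 2) d0) -(qpochM d d0) => E.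
exact: cancel1 (qpoch_unit1 d20 (sq0 x x0)) E.
Qed.

End Point.
End Bilateral.

(** * Enumeration of the infinite dihedral group by the integers *)

Fixpoint alt_word (i : 'I_2) (n : nat) : seq 'I_2 :=
  if n is m.+1 then rcons (alt_word (rev_ord i) m) i else [::].

Lemma refl_word_rcons s i : refl_word (rcons s i) = refl_word s * refl i.
Proof. by rewrite -cats1 refl_word_cat /refl_word big_seq1. Qed.

Lemma rev_ord_or (i j : 'I_2) : j = i \/ j = rev_ord i.
Proof.
case: i j => [[|[|]]//= ?] [[|[|]]//= ?];
  by [left; apply: val_inj | right; apply: val_inj].
Qed.

(** A letter appended to an alternating word either cancels its last letter or prolongs the
    alternation. *)
Lemma refl_word_alt_word s : exists i n, refl_word s = refl_word (alt_word i n).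
Proof.
elim/last_ind: s => [|s j [i [n IHs]]]; first by exists ord0, 0.
rewrite refl_word_rcons IHs; case: (rev_ord_or i j) => ->.
  case: n {IHs} => [|n]; last first.
    exists (rev_ord i), n.
    by rewrite refl_word_rcons -mulrA refl_refl mulr1.
  by exists i, 1; rewrite -refl_word_rcons.
by exists (rev_ord i), n.+1; rewrite /= rev_ordK refl_word_rcons.
Qed.

Definition weyl_of_word (s : seq 'I_2) : weyl :=
  exist _ (refl_word s) (asboolT (ex_intro _ s erefl)).

(** Height of the image of [alpha_j]; for [j = 0] it separates the elements of [W]. *)
Definition height (M : 'M[int]_2) (j : 'I_2) : int := M ord0 j + M ord_max j.

Lemma height_alt_word i n :
  height (refl_word (alt_word i n)) i = 1 - 2 * n%:Z /\
  height (refl_word (alt_word i n)) (rev_ord i) = 1 + 2 * n%:Z.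
Proof.
elim: n i => [|n IHn] i.
  rewrite /height /refl_word /= big_nil !mxE.
  by case: i => [[|[|]]//= ?].
rewrite /= refl_word_rcons; have := IHn (rev_ord i); rewrite rev_ordK.
move: (refl_word _) => M; rewrite /height !mxE !big_ord_recl !big_ord0 !addr0 !reflE.
case: i => [[|[|]]//= i2].
- have -> : rev_ord (Ordinal i2) = ord_max by apply: val_inj.
  have -> : Ordinal i2 = ord0 by apply: val_inj.
  have -> : lift ord0 ord0 = ord_max :> 'I_2 by apply: val_inj.
  by rewrite /= => -[]; lia.
- have -> : rev_ord (Ordinal i2) = ord0 by apply: val_inj.
  have -> : Ordinal i2 = ord_max by apply: val_inj.
  have -> : lift ord0 ord0 = ord_max :> 'I_2 by apply: val_inj.
  by rewrite /= => -[]; lia.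
Qed.

(* The numbering of [W] in which [w_z alpha_0] has height [1 + 2 z]. *)
Definition weyl_int (z : int) : weyl :=
  weyl_of_word (match z with
    | Posz n => alt_word ord_max n
    | Negz n => alt_word ord0 n.+1
    end).

Lemma weyl_int_inj : injective weyl_int.
Proof.
have rev0 : rev_ord ord_max = ord0 :> 'I_2 by apply: val_inj.
have h z : height (sval (weyl_int z)) ord0 = 1 + 2 * z.
  case: z => n; last first.
    by have [-> _] := height_alt_word ord0 n.+1; rewrite NegzE; lia.
  by have [_] := height_alt_word ord_max n; rewrite rev0.
by move=> z z' e; have := h z; rewrite e h; lia.
Qed.

Lemma weyl_int_surj w : exists z, w = weyl_int z.
Proof.
have [i [n wE]] := refl_word_alt_word (weyl_word w).
move: wE; rewrite -weyl_wordP => wE.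
have wP s : sval w = refl_word s -> w = weyl_of_word s.
  by move=> ws; apply: val_inj.
have -> := wP _ wE.
have [->|->] : i = ord_max \/ i = ord0.
- by case: i {wE} => [[|[|]]//= ?]; [right|left]; apply: val_inj.
- by exists (Posz n).
(* The empty word belongs to both families and is numbered 0. *)
by case: n {wE} => [|n]; [exists 0 | exists (Negz n)].
Qed.

(** * The terms of the Weyl sum as rational functions *)

Lemma bterm_recl (A : comUnitRingType) (d u v y : A) n :
  bterm d u v y n.+1 = bfactor u v y * bterm d u v (y * d) n.
Proof.
rewrite /bterm big_ord_recl expr0 mulr1; congr (_ * _).
by apply: eq_bigr => k _; rewrite lift0 exprS mulrA.
Qed.

Lemma rmorph_bterm (F K : fieldType) (f : {rmorphism F -> K}) d u v y n :
  f (bterm d u v y n) = bterm (f d) (f u) (f v) (f y) n.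
Proof.
rewrite /bterm rmorph_prod; apply: eq_bigr => k _; rewrite /bfactor fmorph_div.
by rewrite !(rmorphN, rmorphM, rmorphB, rmorph1, rmorphXn).
Qed.

(** With [X = x_i] and [Y] the other variable, [sigma_i] fixes [d = X Y] and sends [Y] to
    [Y X^2 = X d]. The product based at [Y] thus becomes the one based at [X] without its first
    factor, and the prefactor of the action is that missing factor. *)
Lemma bterm_reflect (F : fieldType) (c X Y : F) n :
  X != 0 -> 1 - c * X != 0 ->
  - X ^+ 2 * ((1 - c / X) / (1 - c * X) *
    bterm (X^-1 * (Y * X ^+ 2)) c 0 (Y * X ^+ 2) n) = bterm (X * Y) c 0 X n.+1.
Proof.
move=> X0 cX0; have YE : Y * X ^+ 2 = X * (X * Y) by ring.
rewrite bterm_recl YE mulKf // mulrA; congr (_ * _); rewrite /bfactor.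
by rewrite mul0r !subr0 sub0r mulr1; field; rewrite X0 cX0.
Qed.

Lemma mulr_div (A : comUnitRingType) (a b c e : A) : b \is a GRing.unit ->
  e \is a GRing.unit -> a / b * (c / e) = a * c / (b * e).
Proof. by move=> bU eU; rewrite invrM // [e^-1 * _]mulrC mulrACA. Qed.

Section Series.
Context {R : idomainType}.
Implicit Types (u : R) (w : weyl) (i : 'I_2) (n : nat).

Local Notation "x %:F" := (@tofrac _ x).
Local Notation x := (('X_ord0 : {mpoly R[2]})%:S).
Local Notation y := (('X_ord_max : {mpoly R[2]})%:S).
Local Notation ratD := (ratX ord0 * ratX ord_max).

Lemma cg0_gen_bterm u i n :
  cg0_gen u i (bterm ratD (ratC u) 0 (ratX (rev_ord i)) n) =
  bterm ratD (ratC u) 0 (ratX i) n.+1.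
Proof.
have X0 := @ratX_neq0 R i; have uX0 := one_sub_ratCX_neq0 u i.
have ij : rev_ord i != i by case: i {X0 uX0} => [[|[|]]].
have DE : ratD = ratX i * ratX (rev_ord i) :> {fraction {mpoly R[2]}}.
  case: i {X0 uX0 ij} => [[|[|]]//= i2]; last rewrite mulrC; congr (ratX _ * ratX _);
    exact: val_inj.
rewrite /cg0_gen /cg_gen rmorph_bterm rmorph0 /= rat_subst_C DE.
rewrite rmorphM /= !rat_subst_X /sigma_pt eqxx (negbTE ij).
exact (bterm_reflect (ratX (rev_ord i)) n X0 uX0).
Qed.

Lemma foldl_alt_word u i n :
  foldl (fun g j => cg0_gen u j g) 1 (alt_word i n) =
  bterm ratD (ratC u) 0 (ratX i) n.
Proof.
elim: n i => [|n IHn] i; first by rewrite /bterm big_ord0.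
by rewrite /= foldl_rcons IHn cg0_gen_bterm.
Qed.

(** * Power series expansions and summation over the group *)

Lemma expandsM f f' (g g' : fps 2 R) :
  expands f g -> expands f' g' -> expands (f * f') (g * g').
Proof.
move=> [p [q [qU -> ->]]] [p' [q' [qU' -> ->]]]; exists (p * p'), (q * q').
rewrite !rmorphM unitrM qU qU' /=; split=> //; last exact (mulr_div _ _ qU qU').
exact (mulf_div _ _ _ _).
Qed.

Lemma expands1 : expands (1 : {fraction {mpoly R[2]}}) 1.
Proof. by exists 1, 1; rewrite !rmorph1 unitr1 !divr1. Qed.

Lemma expands_bfactor u (p : {mpoly R[2]}) : fps_cong 1 p%:S 0 ->
  expands (bfactor (ratC u) 0 p%:F) (bfactor (u%:MP)%:S 0 p%:S).
Proof.
move=> p0; exists (- ((u%:MP - p) * (0 - p))), (1 - u%:MP * p).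
(* One computation serves both the fraction field and the power series ring. *)
have fE (A : comUnitRingType) (f : {rmorphism {mpoly R[2]} -> A}) :
    bfactor (f u%:MP) 0 (f p) = f (- ((u%:MP - p) * (0 - p))) / f (1 - u%:MP * p).
  rewrite /bfactor mul0r subr0 mulr1.
  by rewrite !(rmorphN, rmorphM, rmorphB, rmorph1, rmorph0).
split; [|exact: fE|exact: fE].
by rewrite rmorphB rmorph1 rmorphM; apply/fps_unit_1B/fps_congMl0.
Qed.

Lemma cong_X i : fps_cong 1 (('X_i : {mpoly R[2]})%:S) 0.
Proof. by apply/fps_cong0_const; rewrite /= mcoeffX mnm1_eq0. Qed.

Lemma expands_bterm u i n :
  expands (bterm ratD (ratC u) 0 (ratX i) n)
    (bterm (x * y) (u%:MP)%:S 0 ('X_i : {mpoly R[2]})%:S n).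
Proof.
elim: n => [|n IHn]; first by rewrite /bterm !big_ord0; apply: expands1.
rewrite !btermS; apply: expandsM => //.
pose p : {mpoly R[2]} := 'X_i * ('X_ord0 * 'X_ord_max) ^+ n.
have -> : ratX i * ratD ^+ n = p%:F by rewrite tofracM tofracXn tofracM.
have pE : ('X_i)%:S * (x * y) ^+ n = p%:S by rewrite rmorphM rmorphXn rmorphM.
rewrite pE; apply: expands_bfactor; rewrite -pE mulrC.
exact/fps_congMl0/cong_X.
Qed.

Lemma fps_cong0_v0 u : fps_cong 1 ((u%:MP)%:S * 0 : fps 2 R) 0.
Proof. by rewrite mulr0. Qed.

Definition int_bterm u (z : int) : fps 2 R :=
  match z with
  | Posz n => bterm (x * y) (u%:MP)%:S 0 y n
  | Negz n => bterm (x * y) (u%:MP)%:S 0 x n.+1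
  end.

Lemma expands_weyl_int u z : expands (cg0_act u (weyl_int z) 1) (int_bterm u z).
Proof.
have actE s : cg0_act u (weyl_of_word s) 1 = foldl (fun g j => cg0_gen u j g) 1 s.
  by apply: weyl_actE => //; apply: cg0_genK.
by case: z => n; rewrite actE foldl_alt_word; apply: expands_bterm.
Qed.

Lemma fcoef_int_bterm0 u z m : (mdeg m < `|z|)%N -> fcoef (int_bterm u z) m = 0.
Proof.
move=> mz; rewrite -[RHS](fcoef0 (R := R) m); move: mz.
have u0 := fps_cong0_v0 u; case: z => n /=.
  exact: (bterm_cong0 _ _ (cong_X _) u0).
exact: (bterm_cong0 _ _ (cong_X _) u0).
Qed.

(** The elements numbered from [-N] to [N]. All others contribute only in degrees above [N], see
    [expansion_notin]. *)
Definition weyl_seq N : seq weyl :=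
  [seq weyl_int (Posz n) | n <- iota 0 N.+1] ++
  [seq weyl_int (Negz n) | n <- iota 0 N].

Lemma weyl_seq_uniq N : uniq (weyl_seq N).
Proof.
rewrite cat_uniq !map_inj_uniq ?iota_uniq //; last first.
- by move=> n1 n2 /weyl_int_inj [].
- by move=> n1 n2 /weyl_int_inj [].
rewrite andbT; apply/hasPn => w /mapP[n _ ->].
by apply/negP => /mapP[k _ /weyl_int_inj].
Qed.

Lemma weyl_int_notin z N : weyl_int z \notin weyl_seq N -> (N < `|z|)%N.
Proof.
apply: contraR; rewrite -leqNgt mem_cat; case: z => n zN; apply/orP.
  left; apply: (map_f (fun k => weyl_int (Posz k))).
  by rewrite mem_iota; move: zN => /=; lia.
right; apply: (map_f (fun k => weyl_int (Negz k))).
by rewrite mem_iota; move: zN => /=; lia.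
Qed.

Lemma expansion_notin u w m N : (mdeg m <= N)%N -> w \notin weyl_seq N ->
  fcoef (expansion (cg0_act u w 1)) m = 0.
Proof.
have [z ->] := weyl_int_surj w => mN /weyl_int_notin zN.
rewrite (expansionE (expands_weyl_int u z)) fcoef_int_bterm0 //.
exact: leq_ltn_trans mN zN.
Qed.

Lemma fcoef_sum (I : Type) (r : seq I) (F : I -> fps 2 R) m :
  fcoef (\sum_(i <- r) F i) m = \sum_(i <- r) fcoef (F i) m.
Proof. by apply: (big_morph (fun f => fcoef f m)) => //; apply: fcoef0. Qed.

Lemma weyl_sum_bseries u :
  weyl_sum u = bseries (x * y) (u%:MP)%:S 0 x y.
Proof.
apply/fpsP => m; set N := (mdeg m).+1.
have -> : fcoef (weyl_sum u) m =
    \sum_(w <- weyl_seq N) fcoef (expansion (cg0_act u w 1)) m.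
  rewrite /weyl_sum /= (@fsbigE _ _ _ _ _ (weyl_seq N)) //.
  - by apply: eq_bigl => w; rewrite in_setT.
  - exact: weyl_seq_uniq.
  - by move=> w _; apply: expansion_notin.
rewrite fcoef_bseries -fcoef_sum; congr (fcoef _ m).
have E (f : nat -> int) M :
    \sum_(w <- [seq weyl_int (f k) | k <- iota 0 M]) expansion (cg0_act u w 1) =
    \sum_(k < M) int_bterm u (f k).
  rewrite big_map -(big_mkord xpredT (fun k => int_bterm u (f k))) /index_iota subn0.
  by apply: eq_bigr => k _; apply/expansionE/expands_weyl_int.
(* Number 0 gives the leading 1 of [bsum], positive numbers its [y] half and negative ones its [x]
   half. *)
rewrite big_cat (E Posz) (E Negz) /bsum big_ord_recl; congr (_ + _ + _).
by rewrite /= /bterm big_ord0.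
Qed.

(** * The product [Delta] in terms of infinite q-products *)

Lemma one_sub_root i k :
  (1 - 'X_[real_root i k *+ 2] : {mpoly R[2]})%:S =
  1 - (('X_i : {mpoly R[2]})%:S) ^+ 2 * ((x * y) ^+ 2) ^+ k.
Proof.
rewrite -!(rmorphXn, rmorphM) -(rmorph1 (@fps_of_mpoly 2 R)) -rmorphB.
congr (fps_of_mpoly (_ - _)).
by rewrite exprAC -exprMn -mpolyXD mpolyXn -mpolyXD mpolyXn.
Qed.

Lemma one_sub_delta k :
  (1 - 'X_[delta *+ (2 * k.+1)] : {mpoly R[2]})%:S =
  1 - (x * y) ^+ 2 * ((x * y) ^+ 2) ^+ k.
Proof.
rewrite -exprS -exprM -rmorphM -rmorphXn -(rmorph1 (@fps_of_mpoly 2 R)) -rmorphB.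
by rewrite -mpolyXD mpolyXn.
Qed.

(** The roots [alpha_i + k delta], doubled, give the first two products; the imaginary roots give
    the third. *)
Lemma DeltaE : Delta R =
  qpoch (x ^+ 2) ((x * y) ^+ 2) * qpoch (y ^+ 2) ((x * y) ^+ 2) *
  qpoch ((x * y) ^+ 2) ((x * y) ^+ 2).
Proof.
have p0 : fps_cong 1 ((x * y) ^+ 2) 0.
  by rewrite expr2; apply/fps_congMl0/fps_congMl0/cong_X.
congr (_ * _); last first.
  by congr fps_prod; apply/funext => k; rewrite one_sub_delta.
apply: fps_prod_eq => [k m mk|N]; first by rewrite real_factor_low // fcoef1.
under eq_bigr do rewrite !big_ord_recl big_ord0 mulr1 !one_sub_root.
rewrite big_split; have -> : lift ord0 ord0 = ord_max :> 'I_2 by apply: val_inj.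
by apply: fps_cong_sym; apply: fps_congM; apply: qpoch_cong.
Qed.

End Series.

(* The first two clauses say that the series defining [Z0] makes sense. *)
Theorem theorem6p1 (R : idomainType) (u : R) :
  [/\ forall w : weyl, exists g : fps 2 R, expands (cg0_act u w 1) g,
      fps_summable (fun w : weyl => expansion (cg0_act u w 1)) &
      Z0 u =
        qpoch (u ^+ 2 *: 'X_[delta])%:S ('X_[delta *+ 2])%:S /
        (qpoch (u *: 'X_ord0)%:S ('X_[delta])%:S *
         qpoch (u *: 'X_ord_max)%:S ('X_[delta])%:S)].
Proof.
split.
- by move=> w; have [z ->] := weyl_int_surj w; eexists; apply: expands_weyl_int.
- move=> m; apply: sub_finite_set (finite_seq (weyl_seq (mdeg m))) => w /=.
  by apply: contra_neqT => /(expansion_notin u (leqnn _)) ->.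
have dE : ('X_[delta] : {mpoly R[2]})%:S = ('X_ord0)%:S * ('X_ord_max)%:S.
  by rewrite -rmorphM -mpolyXD.
have d2E : ('X_[delta *+ 2] : {mpoly R[2]})%:S = (('X_ord0)%:S * ('X_ord_max)%:S) ^+ 2.
  by rewrite -dE -rmorphXn mpolyXn.
have uE (c : R) (p : {mpoly R[2]}) : (c *: p)%:S = (c%:MP)%:S * p%:S.
  by rewrite -mul_mpolyC rmorphM.
have cE : ((u ^+ 2)%:MP)%:S = (u%:MP)%:S ^+ 2 :> fps 2 R by rewrite !rmorphXn.
rewrite d2E !uE cE dE /Z0 weyl_sum_bseries.
have x0 := cong_X (R := R) ord0; have y0 := cong_X (R := R) ord_max.
(* By [bseries00] and [DeltaE] the remaining factor [S(0, 0)] is [Delta], which cancels the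
   [Delta^-1] of [Z0]. *)
have E := etrans (bseries_v0 x0 y0 (u%:MP)%:S)
  (congr1 ( *%R _) (etrans (bseries00 x0 y0) (esym DeltaE))).
have d0 : fps_cong 1 (('X_ord0 : {mpoly R[2]})%:S * ('X_ord_max)%:S) 0.
  exact/fps_congMl0/cong_X.
have qU i := qpoch_unit1 d0 (fps_congMl0 (u%:MP)%:S (cong_X i)).
have divE (A : comUnitRingType) (a b c w : A) : a \is a GRing.unit ->
    b \is a GRing.unit -> a * w = c * b -> b^-1 * w = c / a.
  move=> aU bU awE; apply: (mulrI aU); apply: (mulrI bU).
  by rewrite [a * (c / a)]mulrC divrK // [LHS]mulrCA mulVKr // awE mulrC.
by apply: divE E; [rewrite unitrM !qU | exact: Delta_unit].
Qed.
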